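(* In a PX instance, an exchange $(\mathcal{C},f)$ is Pareto optimal if and only if it is maximal, trade-in-free and coalition-free.
   Context: A PX instance consists of a finite directed graph $D=(V,A)$ without loops or parallel arcs, a capacity function $c:A\to\mathbb{R}_{>0}$, and, for each agent $v\in V$, a strict total order $>_v$ (the preference list of $v$) on $\{u:(v,u)\in A\}$; $u_1>_v u_2$ means $v$ prefers $u_1$. A packing is a finite set $\mathcal{C}$ of directed cycles of $D$. For $e\in A$ let $\mathcal{C}_e$ be the set of cycles of $\mathcal{C}$ containing $e$. An exchange function is $f:\mathcal{C}\to\mathbb{R}_{>0}$ with $f(e):=\sum_{C\in\mathcal{C}_e}f(C)\le c(e)$ for all $e\in A$ ($f(e)=0$ if no cycle contains $e$); an exchange is a pair $(\mathcal{C},f)$. If $v$ has preference list $v_1>_v\cdots>_v v_z$, then $(\mathcal{C},f)>_v(\mathcal{C}',f')$ means there is $k$ with $f((v,v_i))=f'((v,v_i))$ for $i<k$ and $f((v,v_k))>f'((v,v_k))$. $(\mathcal{C}',f')$ dominates $(\mathcal{C},f)$ if no agent $v$ has $(\mathcal{C},f)>_v(\mathcal{C}',f')$ and some agent $u$ has $(\mathcal{C}',f')>_u(\mathcal{C},f)$; an exchange is Pareto optimal if no exchange dominates it. For an exchange $(\mathcal{C},f)$ let $A_{\mathcal{C}}=\{e\in A: f(e)>0\}$ and let $D'=(V,A')$ with $A'=\{e\in A: c(e)-f(e)>0\}$. The exchange is (i) maximal if $D'$ is acyclic; (ii) trade-in-free if for every $(v,u)\in A_{\mathcal{C}}$ there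 is no directed path $(v,t,\ldots,u)$ in $D'$ from $v$ to $u$ whose second vertex $t$ satisfies $t>_v u$; (iii) coalition-free if for every $k\ge1$ and every $(v_1,u_1),\ldots,(v_k,u_k)\in A_{\mathcal{C}}$ there are no directed paths $(v_1,t_1,\ldots,u_2),(v_2,t_2,\ldots,u_3),\ldots,(v_k,t_k,\ldots,u_1)$ in $D'$ (the $i$-th from $v_i$ to $u_{i+1}$, indices mod $k$, with second vertex $t_i$) such that $t_i>_{v_i}u_i$ for every $i\in\{1,\ldots,k\}$. *)

(* Defs.v *)
From mathcomp Require Import all_boot all_order all_algebra.
From mathcomp Require Import reals.

Set Implicit Arguments.
Unset Strict Implicit.
Unset Printing Implicit Defensive.

Import Order.TTheory GRing.Theory Num.Theory.
Local Open Scope ring_scope.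

Definition arc_rel (V : finType) (E : {set V * V}) : rel V :=
  fun x y => (x, y) \in E.

(* A directed cycle is represented by its set of arcs, so that cyclic
   rotations of the same vertex sequence are identified. The condition
   [s != [::]] is needed because [path.cycle] accepts the empty sequence. *)
Definition is_dicycle (V : finType) (E C : {set V * V}) : Prop :=
  exists s : seq V,
    [/\ s != [::], uniq s, path.cycle (arc_rel E) s
      & C = [set (x, next s x) | x in s]].

Definition acyclic (V : finType) (E : {set V * V}) : Prop :=
  forall C : {set V * V}, ~ is_dicycle E C.

(* There is a directed path (v, t, ..., u), with pairwise distinct vertices;
   [t = u] is allowed. *)
Definition dipath_via (V : finType) (E : {set V * V}) (v t u : V) : Prop :=
  exists p : seq V,
    [/\ path (arc_rel E) v (t :: p), uniq [:: v, t & p] & last t p = u].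

(* [px_pref v u1 u2] reads u1 >_v u2; it is only constrained, and only used,
   on the out-neighbours of v. Likewise [px_cap] only matters on arcs. *)
Record px_instance (R : realType) (V : finType) := PXInstance {
  px_arcs : {set V * V};
  px_loopless : forall v, (v, v) \notin px_arcs;
  px_cap : V * V -> R;
  px_cap_gt0 : forall e, e \in px_arcs -> 0 < px_cap e;
  px_pref : V -> rel V;
  px_pref_irr : forall v u, (v, u) \in px_arcs -> ~~ px_pref v u u;
  px_pref_trans : forall v u1 u2 u3,
    (v, u1) \in px_arcs -> (v, u2) \in px_arcs -> (v, u3) \in px_arcs ->
    px_pref v u1 u2 -> px_pref v u2 u3 -> px_pref v u1 u3;
  px_pref_total : forall v u1 u2,
    (v, u1) \in px_arcs -> (v, u2) \in px_arcs -> u1 != u2 ->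
    px_pref v u1 u2 || px_pref v u2 u1
}.

Definition arc_value (R : realType) (V : finType)
    (P : {set {set V * V}}) (f : {set V * V} -> R) (e : V * V) : R :=
  \sum_(C in P | e \in C) f C.

(* The values of [ex_fun] outside the packing are irrelevant. *)
Record exchange (R : realType) (V : finType) (I : px_instance R V) := Exchange {
  ex_packing : {set {set V * V}};
  ex_packing_dicycle : forall C, C \in ex_packing -> is_dicycle (px_arcs I) C;
  ex_fun : {set V * V} -> R;
  ex_fun_gt0 : forall C, C \in ex_packing -> 0 < ex_fun C;
  ex_fun_le_cap : forall e, e \in px_arcs I ->
    arc_value ex_packing ex_fun e <= px_cap I e
}.

Definition flow (R : realType) (V : finType) (I : px_instance R V)
    (X : exchange I) (e : V * V) : R :=
  arc_value (ex_packing X) (ex_fun X) e.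

(* [w] is the entry v_k of the preference list of v; the entries v_i with
   i < k are exactly the out-neighbours that v prefers to [w]. *)
Definition prefers (R : realType) (V : finType) (I : px_instance R V)
    (v : V) (X Y : exchange I) : Prop :=
  exists w : V,
    [/\ (v, w) \in px_arcs I,
        forall w' : V, (v, w') \in px_arcs I -> px_pref I v w' w ->
          flow X (v, w') = flow Y (v, w')
      & flow Y (v, w) < flow X (v, w)].

Definition dominates (R : realType) (V : finType) (I : px_instance R V)
    (Y X : exchange I) : Prop :=
  (forall v : V, ~ prefers v X Y) /\ (exists u : V, prefers u Y X).

Definition pareto_optimal (R : realType) (V : finType) (I : px_instance R V)
    (X : exchange I) : Prop :=
  forall Y : exchange I, ~ dominates Y X.

Definition used_arcs (R : realType) (V : finType) (I : px_instance R V)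
    (X : exchange I) : {set V * V} :=
  [set e in px_arcs I | 0 < flow X e].

Definition residual_arcs (R : realType) (V : finType) (I : px_instance R V)
    (X : exchange I) : {set V * V} :=
  [set e in px_arcs I | 0 < px_cap I e - flow X e].

Definition maximal_exchange (R : realType) (V : finType) (I : px_instance R V)
    (X : exchange I) : Prop :=
  acyclic (residual_arcs X).

Definition trade_in_free (R : realType) (V : finType) (I : px_instance R V)
    (X : exchange I) : Prop :=
  forall v u : V, (v, u) \in used_arcs X ->
    ~ exists t : V, px_pref I v t u /\ dipath_via (residual_arcs X) v t u.

(* [ordS i] is the cyclic successor of [i], i.e. [i.+1 %% k]. *)
Definition coalition_free (R : realType) (V : finType) (I : px_instance R V)
    (X : exchange I) : Prop :=
  forall (k : nat) (v u : 'I_k -> V), (1 <= k)%N ->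
    (forall i, (v i, u i) \in used_arcs X) ->
    ~ exists t : 'I_k -> V, forall i,
        px_pref I (v i) (t i) (u i) /\
        dipath_via (residual_arcs X) (v i) (t i) (u (ordS i)).

(* Main.v *)
(** Pareto optimality is governed by improving circulations: circulations [d]
    that are positive only on residual arcs, negative only on used arcs, and
    such that every agent losing on an arc gains on an arc it prefers. If [Y]
    dominates [X], the difference of the flows is one; conversely, a small
    multiple of an improving circulation can be added to the flow of [X], and
    flow decomposition turns the sum into an exchange that dominates [X].

    A residual cycle gives an improving circulation, and so does a coalition:
    add one unit along each path and remove one unit from each arc
    [(v_i, u_i)]; the best arc among those [v_i] moves to cannot cancel,
    because [v_i] prefers it to everything it gives up. Conversely, let [S] be
    the set of agents that gain on some arc. From each agent of [S], follow the
    best gaining arcs until leaving [S], which happens because the residual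
    graph is acyclic. Conservation at the exit vertex [u] provides an arc
    [(w, u)] with a loss, and [w] is again in [S]. A periodic point of the map
    sending the first agent to [w] is a coalition; its paths are simple because
    only their last vertex lies outside [S]. A trade-in is a coalition with
    [k = 1]. *)

Require Import Defs.
From mathcomp Require Import all_boot all_order all_algebra.
From mathcomp Require Import reals.
From mathcomp Require Import lra.

Set Implicit Arguments.
Unset Strict Implicit.
Unset Printing Implicit Defensive.

Import Order.TTheory GRing.Theory Num.Theory.
Local Open Scope ring_scope.

(** * Circulations and improving circulations *)

Definition circulation (R : realType) (V : finType) (g : V * V -> R) : Prop :=
  forall v, \sum_w g (v, w) = \sum_w g (w, v).

Record improving (R : realType) (V : finType) (I : px_instance R V)
    (X : exchange I) (d : V * V -> R) : Prop := Improving {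
  improving_circ : circulation d;
  improving_gt0 : forall e, 0 < d e -> e \in residual_arcs X;
  improving_lt0 : forall e, d e < 0 -> e \in used_arcs X;
  improving_pref : forall v w, d (v, w) < 0 ->
    exists t, 0 < d (v, t) /\ px_pref I v t w;
  improving_neq0 : exists e, d e != 0
}.

(** * Periodic points, cycles and exit paths of a map on a finite set *)

(** The orbit of [x0] loops: its iterate of rank [order f x0] equals an earlier one, of rank [i],
    which is therefore periodic. *)
Lemma periodic_point (T : finType) (f : T -> T) (S : pred T) (x0 : T) :
  (forall x, S x -> S (f x)) -> S x0 ->
  exists2 y, S y & exists2 k, (0 < k)%N & iter k f y = y.
Proof.
move=> fS Sx0.
have Sit n : S (iter n f x0) by elim: n => //= n; apply: fS.
have /trajectP[i lt_i Hi] := looping_order f x0.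
exists (iter i f x0); first exact: Sit.
exists (order f x0 - i)%N; first by rewrite subn_gt0.
by rewrite -iterD subnK // ltnW.
Qed.

Lemma dicycle_of_stable_map (V : finType) (E : {set V * V}) (f : V -> V)
    (S : pred V) (x0 : V) :
  (forall x, S x -> S (f x)) -> (forall x, S x -> (x, f x) \in E) -> S x0 ->
  exists C, is_dicycle E C.
Proof.
move=> fS fE Sx0; have [y Sy [k k_gt0 Hk]] := periodic_point fS Sx0.
have cyc : fcycle f (orbit f y).
  (* [y] is an iterate of [f y], so its orbit closes up into a cycle. *)
  by rewrite -fconnect_f -{2}Hk -(prednK k_gt0) iterSr fconnect_iter.
have Sorb x : x \in orbit f y -> S x.
  by case/trajectP=> i _ ->; elim: i => //= i; apply: fS.
exists [set (x, next (orbit f y) x) | x in orbit f y], (orbit f y); split=> //.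
- by rewrite /orbit -orderSpred.
- apply: (@sub_in_cycle _ S (frel f)) cyc; last by apply/allP=> x /Sorb.
  by move=> x y' Sx _ /eqP <-; apply: fE.
Qed.

(** Iterating [f] must leave [S], since an orbit inside [S] would contain a cycle of [E]. Up to the
    first exit the vertices are distinct: a repetition would put the exit vertex among its
    predecessors, which lie in [S]. *)
Lemma exit_dipath (V : finType) (E : {set V * V}) (f : V -> V) (S : pred V)
    (v : V) :
  acyclic E -> (forall x, S x -> (x, f x) \in E) -> S v ->
  exists u, [/\ ~~ S u, dipath_via E v (f v) u & exists2 y, S y & u = f y].
Proof.
move=> acE fE Sv.
have [|noex] := boolP [exists n : 'I_(order f v).+1, ~~ S (iter n f v)].
  case/existsP=> n0 Hn0.
  have ex : exists n, ~~ S (iter n f v) by exists n0.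
  case: (ex_minnP ex) => -[|n] Hn min; first by rewrite /= Sv in Hn.
  have Slt i : (i <= n)%N -> S (iter i f v).
    by move=> le_in; apply: contraT => /min; rewrite ltnNge le_in.
  exists (iter n.+1 f v); split=> //; last by exists (iter n f v); rewrite ?Slt.
  exists (traject f (f (f v)) n); split.
  - change (path (arc_rel E) v (traject f (f v) n.+1)).
    apply/(pathP v) => i; rewrite size_traject => lt_i.
    rewrite -trajectS nth_traject 1?ltnW // (set_nth_default (f v)) ?size_traject //.
    rewrite nth_traject // -iterSr iterS.
    by apply: fE; apply: Slt.
  - change (uniq (traject f v n.+2)); rewrite looping_uniq.
    apply/trajectP=> -[i lt_i Hi].
    by move: Hn; rewrite Hi Slt.
  - by rewrite last_traject -!iterSr.
exfalso.
have Sall n : S (iter n f v).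
  have /loopingP/(_ n)/trajectP[i lt_i ->] := looping_order f v.
  rewrite negb_exists in noex; move/forallP: noex.
  by move/(_ (Ordinal (ltnW lt_i : (i < (order f v).+1)%N))); rewrite negbK.
have [] := @dicycle_of_stable_map V E f (fconnect f v) v.
- by move=> x; rewrite fconnect_orbit => /trajectP[i _ ->]; rewrite -iterS fconnect_iter.
- by move=> x; rewrite fconnect_orbit => /trajectP[i _ ->]; apply/fE/Sall.
- exact: connect0.
- by move=> C /acE.
Qed.

(** * Best out-neighbours *)

(** Take [t] in [Q] preferred to as many elements of [Q] as possible: an element preferred to [t]
    would be preferred to all of these and to [t] as well. *)
Lemma top_choice (R : realType) (V : finType) (I : px_instance R V) (v : V)
    (Q : pred V) (w0 : V) :
  (forall w, Q w -> (v, w) \in px_arcs I) -> Q w0 ->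
  exists t, [/\ Q t, forall w, Q w -> w != t -> px_pref I v t w
    & forall w, Q w -> ~~ px_pref I v w t].
Proof.
move=> QA Qw0.
case: (@arg_maxnP _ w0 Q (fun t => #|[set w | Q w && px_pref I v t w]|) Qw0).
move=> t Qt tmax.
have not_better w : Q w -> ~~ px_pref I v w t.
  move=> Qw; apply/negP=> wt; have := tmax w Qw; rewrite /geq /= leqNgt => /negP[].
  apply: proper_card; apply/properP; split.
    apply/subsetP=> x; rewrite !inE => /andP[Qx tx]; rewrite Qx /=.
    exact: (px_pref_trans (QA _ Qw) (QA _ Qt) (QA _ Qx) wt tx).
  by exists t; rewrite !inE Qt // (negPf (px_pref_irr (QA _ Qt))).
exists t; split=> // w Qw wt.
by have := px_pref_total (QA _ Qw) (QA _ Qt) wt; rewrite (negPf (not_better _ Qw)).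
Qed.

(** * Flows as circulations, and their decomposition into cycles *)

Lemma dicycle_sub (V : finType) (E C : {set V * V}) :
  is_dicycle E C -> C \subset E.
Proof.
case=> s [_ _ cyc ->]; apply/subsetP=> e /imsetP[x xs ->].
exact: next_cycle cyc xs.
Qed.

(** A vertex [v] of the cycle has exactly one arc out, to [next s v], and one in, from [prev s v];
    other vertices have none. *)
Lemma dicycle_circulation (R : realType) (V : finType) (E C : {set V * V}) :
  is_dicycle E C -> circulation (fun e => (e \in C)%:R : R).
Proof.
case=> s [_ us _ ->] v.
have [vs|vs] := boolP (v \in s); last first.
  rewrite !big1 // => w _; rewrite (_ : _ \in _ = false) //; apply/imsetP=> -[x xs []].
    by move=> _ Ev; rewrite Ev mem_next xs in vs.
  by move=> Ev; rewrite Ev xs in vs.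
rewrite (bigD1 (next s v)) //= imset_f // big1 => [|w nw]; last first.
  rewrite (_ : _ \in _ = false) //; apply/imsetP=> -[x xs [Ev Ew]].
  by rewrite Ew -Ev eqxx in nw.
rewrite (bigD1 (prev s v)) //= big1 => [|w nw]; last first.
  rewrite (_ : _ \in _ = false) //; apply/imsetP=> -[x xs [Ev Ew]].
  by rewrite Ew prev_next // Ev eqxx in nw.
rewrite (_ : _ \in _) //; apply/imsetP; exists (prev s v); rewrite ?mem_prev //.
by rewrite next_prev.
Qed.

Lemma circulationD (R : realType) (V : finType) (g h : V * V -> R) (a : R) :
  circulation g -> circulation h -> circulation (fun e => g e + a * h e).
Proof.
by move=> cg ch v; rewrite !big_split /= -!mulr_sumr cg ch.
Qed.

Lemma flow_circulation (R : realType) (V : finType) (I : px_instance R V)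
    (X : exchange I) : circulation (flow X).
Proof.
have flowE e : flow X e =
    \sum_(C in ex_packing X) ex_fun X C * (e \in C)%:R.
  rewrite /flow /arc_value big_mkcondr /=; apply: eq_bigr => C _.
  by case: ifP; rewrite ?mulr1 ?mulr0.
move=> v; under eq_bigr do rewrite flowE.
under [RHS]eq_bigr do rewrite flowE.
rewrite exchange_big [RHS]exchange_big /=; apply: eq_bigr => C CX.
by rewrite -!mulr_sumr (dicycle_circulation R (ex_packing_dicycle CX)).
Qed.

Lemma flow_out (R : realType) (V : finType) (I : px_instance R V)
    (X : exchange I) (e : V * V) : e \notin px_arcs I -> flow X e = 0.
Proof.
move=> eA; rewrite /flow /arc_value big1 // => C /andP[CX eC].
by rewrite (subsetP (dicycle_sub (ex_packing_dicycle CX)) _ eC) in eA.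
Qed.

Lemma flow_ge0 (R : realType) (V : finType) (I : px_instance R V)
    (X : exchange I) (e : V * V) : 0 <= flow X e.
Proof. by apply: sumr_ge0 => C /andP[/ex_fun_gt0/ltW]. Qed.

(** Induction on the size of the support. By conservation every nonzero arc is continued by another,
    so the support contains a cycle; subtracting the least value along it removes an arc from the
    support. *)
Lemma flow_decomposition (R : realType) (V : finType) (E : {set V * V})
    (g : V * V -> R) :
  (forall e, 0 <= g e) -> (forall e, e \notin E -> g e = 0) -> circulation g ->
  exists F : {set V * V} -> R,
    [/\ forall C, 0 <= F C, forall C, F C != 0 -> is_dicycle E C
      & forall e, \sum_(C : {set V * V} | e \in C) F C = g e].
Proof.
have [n] := ubnP #|[set e | g e != 0]|; elim: n g => // n IHn g ltn g0 gE cg.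
have [/existsP[[x0 y0] gxy]|no] := boolP [exists e, g e != 0]; last first.
  rewrite negb_exists in no; exists (fun=> 0); split=> // [C|e].
    by rewrite eqxx.
  by rewrite big1 //; apply/esym/eqP; rewrite -[_ == _]negbK; apply/forallP: e.
pose S x := [exists y, g (x, y) != 0].
have outS x y : g (x, y) != 0 -> S y.
  move=> gn; apply: contraT; rewrite negb_exists => /forallP no.
  have /eqP := cg y; rewrite big1 => [|w _]; last by apply/eqP; rewrite -[_ == _]negbK.
  rewrite eq_sym psumr_eq0 // => /allP/(_ x); rewrite mem_index_enum /= => /(_ isT).
  by rewrite (negPf gn).
have [f Hf] : exists f : V -> V, forall x, S x -> g (x, f x) != 0.
  apply: (@fin_all_exists V (fun=> V) (fun x y => S x -> g (x, y) != 0)) => x.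
  by have [/existsP[y ?]|] := boolP (S x); [exists y | exists x].
have [C dC] : exists C, is_dicycle [set e | g e != 0] C.
  apply: (@dicycle_of_stable_map _ _ f S x0).
  - by move=> x /Hf/outS.
  - by move=> x /Hf; rewrite inE.
  - by apply/existsP; exists y0.
have subC := subsetP (dicycle_sub dC).
have [e0 e0C] : exists e, e \in C.
  case: dC => -[|x s] [] // _ _ _ ->; exists (x, next (x :: s) x).
  by rewrite imset_f ?mem_head.
have dCE : is_dicycle E C.
  case: dC => s [s0 us cs ->]; exists s; split=> //; apply: sub_cycle cs => x y.
  by rewrite /arc_rel inE; apply: contraNT => /gE ->.
have [e1 e1C e1min] : exists2 e, e \in C & forall e', e' \in C -> g e <= g e'.
  by case: (@arg_minP _ _ _ e0 (mem C) g e0C) => e ? ?; exists e.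
pose a := g e1; pose g' e := g e + - a * (e \in C)%:R.
have a_gt0 : 0 < a by rewrite lt_neqAle eq_sym g0 andbT; have := subC _ e1C; rewrite inE.
case: (IHn g').
- apply: (@leq_trans #|[set e | g e != 0]|); last by rewrite -ltnS.
  apply: proper_card.
  apply/properP; split.
    apply/subsetP=> e; rewrite !inE /g'; have [/subC|] := boolP (e \in C).
      by rewrite inE.
    by rewrite mulr0 addr0.
  by exists e1; rewrite ?subC // inE /g' e1C mulr1 subrr eqxx.
- move=> e; rewrite /g'; have [/e1min|_] := boolP (e \in C); last by rewrite mulr0 addr0.
  by rewrite mulr1 subr_ge0.
- move=> e eE; rewrite /g' gE //; have [/(subsetP (dicycle_sub dCE))|] := boolP (e \in C).
    by rewrite (negPf eE).
  by rewrite mulr0 addr0.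
- by apply: circulationD cg _; apply: dicycle_circulation dC.
move=> F [F0 FE Fg]; exists (fun D => F D + a * (D == C)%:R); split.
- by move=> D; rewrite addr_ge0 // mulr_ge0 ?ler0n // ltW.
- move=> D; case: (D =P C) => [-> //|_]; rewrite mulr0 addr0; exact: FE.
- move=> e; rewrite big_split /= Fg -mulr_sumr /g' mulNr.
  suff -> : \sum_(D : {set V * V} | e \in D) (D == C)%:R = (e \in C)%:R :> R.
    by rewrite subrK.
  have [eC|eC] := boolP (e \in C).
    by rewrite (bigD1 C) //= eqxx big1 ?addr0 // => D /andP[_ /negPf->].
  by rewrite big1 // => D eD; case: eqP eD => // ->; rewrite (negPf eC).
Qed.

(** [ex_fun] has to be positive on the packing, so only the cycles of nonzero weight in a
    decomposition of [g] are kept. *)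
Lemma exchange_of_circulation (R : realType) (V : finType)
    (I : px_instance R V) (g : V * V -> R) :
  (forall e, 0 <= g e) -> (forall e, e \notin px_arcs I -> g e = 0) ->
  (forall e, e \in px_arcs I -> g e <= px_cap I e) -> circulation g ->
  exists Y : exchange I, forall e, flow Y e = g e.
Proof.
move=> g0 gA gc cg; have [F [F0 FE Fg]] := flow_decomposition g0 gA cg.
pose P := [set C | F C != 0].
have PF e : arc_value P F e = g e.
  rewrite -Fg /arc_value [RHS](bigID (fun C => C \in P)) /= [X in _ + X]big1 ?addr0.
    by apply: eq_bigl => C; rewrite andbC.
  by move=> C /andP[_]; rewrite inE negbK => /eqP.
have PD C : C \in P -> is_dicycle (px_arcs I) C by rewrite inE => /FE.
have P0 C : C \in P -> 0 < F C by rewrite inE lt_neqAle eq_sym F0 andbT.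
have Pc e : e \in px_arcs I -> arc_value P F e <= px_cap I e by rewrite PF; apply: gc.
by exists (Exchange PD P0 Pc).
Qed.

(** * Improving circulations and domination *)

(** Gives one step size for all arcs: the least of finitely many thresholds, where the default 1
    covers an empty [T]. *)
Lemma common_small (R : realType) (T : finType) (P : T -> R -> Prop) :
  (forall t, exists2 a, 0 < a & forall b, 0 < b <= a -> P t b) ->
  exists2 a, 0 < a & forall t, P t a.
Proof.
move=> /fin_all_exists2[a a0 Pa]; pose b := \big[Num.min/1]_t a t.
have b0 : 0 < b by rewrite /b; elim/big_ind: _ => // x y; rewrite lt_min => -> ->.
by exists b => // t; apply: Pa; rewrite b0 /= /b bigmin_le_cond.
Qed.

Lemma improving_arc (R : realType) (V : finType) (I : px_instance R V)
    (X : exchange I) (d : V * V -> R) (e : V * V) :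
  improving X d -> d e != 0 -> e \in px_arcs I.
Proof.
case=> _ d_gt0 d_lt0 _ _.
by case: ltgtP => // [/d_lt0|/d_gt0]; rewrite inE => /andP[].
Qed.

(** The best arc of nonzero value at [v] is a gain, since a loss there would come with a gain on a
    preferred arc. *)
Lemma improving_top (R : realType) (V : finType) (I : px_instance R V)
    (X : exchange I) (d : V * V -> R) (v w0 : V) :
  improving X d -> d (v, w0) != 0 ->
  exists t, [/\ 0 < d (v, t),
    forall w, d (v, w) < 0 -> px_pref I v t w
    & forall w, d (v, w) != 0 -> ~~ px_pref I v w t].
Proof.
move=> dX d0; have [t [dt tmax tbest]] :=
  top_choice (Q := fun w => d (v, w) != 0) (fun w => improving_arc dX) d0.
have dt0 : 0 < d (v, t).
  case: ltgtP dt => // /(improving_pref dX)[w [dw wt]] _.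
  by rewrite (negPf (tbest _ (lt0r_neq0 dw))) in wt.
exists t; split=> // w dw; apply: tmax; first exact: ltr0_neq0.
by apply: contraTneq dw => ->; rewrite -leNgt ltW.
Qed.

Lemma improving_not_pareto (R : realType) (V : finType) (I : px_instance R V)
    (X : exchange I) (d : V * V -> R) :
  improving X d -> ~ pareto_optimal X.
Proof.
move=> dX optX; have [cd d_gt0 d_lt0 dpref [[v0 w0] d0]] := dX.
have dA e : d e != 0 -> e \in px_arcs I by apply: improving_arc dX.
(* Losses bound [a] by the present flow on the arc, gains by its residual capacity. *)
have [a a0 Ha] : exists2 a, 0 < a & forall e,
    0 <= flow X e + a * d e /\ (e \in px_arcs I -> flow X e + a * d e <= px_cap I e).
  apply: common_small => e; have fe0 := flow_ge0 X e.
  have fec (eA : e \in px_arcs I) : flow X e <= px_cap I e := ex_fun_le_cap X eA.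
  have [de|de|de] := ltgtP (d e) 0.
  - have := d_lt0 _ de; rewrite inE => /andP[_ fe].
    exists (flow X e / - d e); first by rewrite divr_gt0 // oppr_gt0.
    move=> b /andP[b0]; rewrite ler_pdivlMr ?oppr_gt0 // => bde; split; first by lra.
    by move/fec; nra.
  - have := d_gt0 _ de; rewrite inE => /andP[_ fe].
    exists ((px_cap I e - flow X e) / d e); first by rewrite divr_gt0.
    by move=> b /andP[b0]; rewrite ler_pdivlMr // => bde; split; [nra | lra].
  - by exists 1 => // b _; rewrite de mulr0 addr0.
have [Y HY] : exists Y : exchange I, forall e, flow Y e = flow X e + a * d e.
  apply: exchange_of_circulation => [e|e eA|e|].
  - by case: (Ha e).
  - rewrite flow_out // add0r (_ : d e = 0) ?mulr0 //; apply/eqP.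
    by apply: contraNT eA => /dA.
  - by case: (Ha e).
  - exact: circulationD (flow_circulation X) cd.
apply: (optX Y); split.
  (* If [v] preferred [X] at [w], it would lose on [(v, w)], hence gain on a preferred arc, where
     the two flows were to agree. *)
  move=> v [w [vw eqw]]; rewrite HY => lt; have /dpref[t [dt tw]] : d (v, w) < 0 by nra.
  have := eqw t (dA _ (lt0r_neq0 dt)) tw; rewrite HY; nra.
(* [v0] prefers [Y], as witnessed by its best arc of nonzero value. *)
have [t [dt _ tbest]] := improving_top dX d0.
exists v0, t; split; first by apply: dA; rewrite lt0r_neq0.
  move=> w vw wt; rewrite HY; have [->|/tbest] := eqVneq (d (v0, w)) 0.
    by rewrite mulr0 addr0.
  by rewrite wt.
by rewrite HY; nra.
Qed.

(** Gains lie on residual arcs because [Y] respects capacities, losses on used arcs because flows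
    are nonnegative. The factor [-1] puts the difference into the form of [circulationD]. *)
Lemma dominates_improving (R : realType) (V : finType) (I : px_instance R V)
    (X Y : exchange I) :
  dominates Y X -> improving X (fun e => flow Y e + (-1) * flow X e).
Proof.
case=> noX [u [w [uw _ ltw]]].
have out e : e \notin px_arcs I -> flow Y e + (-1) * flow X e = 0.
  by move=> eA; rewrite !flow_out // mulr0 addr0.
have ne0A e : flow Y e + (-1) * flow X e != 0 -> e \in px_arcs I.
  by apply: contraNT => /out ->.
split.
- by apply: circulationD; apply: flow_circulation.
- move=> e e0; have eA := ne0A _ (lt0r_neq0 e0); rewrite inE eA /=.
  have : flow Y e <= px_cap I e := ex_fun_le_cap Y eA; lra.
- move=> e e0; rewrite inE ne0A ?ltr0_neq0 //=; have := flow_ge0 Y e; lra.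
- move=> v x dx.
  (* On the best arc where the two flows differ [v] must gain: a loss would make [v] prefer [X] to
     [Y]. *)
  have [t [dt tmax tbest]] :=
    top_choice (Q := fun x => flow Y (v, x) + (-1) * flow X (v, x) != 0)
      (fun x => @ne0A (v, x)) (ltr0_neq0 dx).
  exists t; have d_gt0 : 0 < flow Y (v, t) + (-1) * flow X (v, t).
    case: ltgtP (dt) => // lt0 _; case: (noX v); exists t; split; first exact: ne0A.
      move=> y vy yt; suff/eqP : flow Y (v, y) + (-1) * flow X (v, y) == 0 by lra.
      by apply: contraLR yt; apply: tbest.
    by lra.
  split=> //; apply: tmax; first exact: ltr0_neq0.
  by apply: contraTneq dx => ->; rewrite -leNgt ltW.
- by exists (u, w); rewrite lt0r_neq0 //; lra.
Qed.

(** * Improving circulations from cycles and coalitions *)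

Lemma dicycle_improving (R : realType) (V : finType) (I : px_instance R V)
    (X : exchange I) (C : {set V * V}) :
  is_dicycle (residual_arcs X) C -> improving X (fun e => (e \in C)%:R).
Proof.
move=> dC; split.
- exact: dicycle_circulation dC.
- by move=> e; rewrite ltr0n lt0b; apply: (subsetP (dicycle_sub dC)).
- by move=> e; rewrite ltrn0.
- by move=> v w; rewrite ltrn0.
- case: dC => -[|x s] [] // _ _ _ ->; exists (x, next (x :: s) x).
  by rewrite imset_f ?mem_head // oner_eq0.
Qed.

Definition path_arcs (V : finType) (x : V) (p : seq V) : seq (V * V) :=
  pairmap pair x p.

Lemma path_arcs_out (V : finType) (x v : V) (p : seq V) :
  (\sum_w count_mem (v, w) (path_arcs x p) = count_mem v (belast x p))%N.
Proof.
elim: p x => [|y p IH] x /=; first by rewrite big1.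
rewrite big_split /= IH; congr addn; rewrite (bigD1 y) //= big1 ?addn0.
  by rewrite xpair_eqE eqxx andbT.
by move=> w wy; rewrite xpair_eqE [y == w]eq_sym (negPf wy) andbF.
Qed.

Lemma path_arcs_in (V : finType) (x v : V) (p : seq V) :
  (\sum_w count_mem (w, v) (path_arcs x p) = count_mem v p)%N.
Proof.
elim: p x => [|y p IH] x /=; first by rewrite big1.
rewrite big_split /= IH; congr addn; rewrite (bigD1 x) //= big1 ?addn0.
  by rewrite xpair_eqE eqxx.
by move=> w wx; rewrite xpair_eqE [x == w]eq_sym (negPf wx).
Qed.

(** Both sides count [v] in [x :: p], with the last vertex split off on the left and the first on
    the right. *)
Lemma path_arcs_balance (V : finType) (x v : V) (p : seq V) :
  (\sum_w count_mem (v, w) (path_arcs x p) + (last x p == v) =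
   \sum_w count_mem (w, v) (path_arcs x p) + (x == v))%N.
Proof.
rewrite path_arcs_out path_arcs_in addnC [RHS]addnC.
have := congr1 (count_mem v) (lastI x p); rewrite -cats1 count_cat /= addn0.
by rewrite [RHS]addnC.
Qed.

Lemma mem_path_arcs (V : finType) (E : {set V * V}) (x : V) (p : seq V) :
  path (arc_rel E) x p -> {subset path_arcs x p <= E}.
Proof.
elim: p x => //= y p IH x /andP[xy yp] e; rewrite inE => /predU1P[-> //|].
exact: IH yp e.
Qed.

(** An agent may occur several times, and paths may share arcs with each other or with the arcs
    given up, so [d] counts arcs with multiplicity and sign. *)
Lemma coalition_improving (R : realType) (V : finType) (I : px_instance R V)
    (X : exchange I) (k : nat) (v u t : 'I_k -> V) :
  (0 < k)%N -> (forall i, (v i, u i) \in used_arcs X) ->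
  (forall i, px_pref I (v i) (t i) (u i) /\
    dipath_via (residual_arcs X) (v i) (t i) (u (ordS i))) ->
  exists d, improving X d.
Proof.
move=> k_gt0 used Ht.
have [p Hp] := fin_all_exists (fun i => proj2 (Ht i)).
pose c i e := count_mem e (path_arcs (v i) (t i :: p i)).
pose d e : R := \sum_i ((c i e)%:R - ((v i, u i) == e)%:R).
have resA e : e \in residual_arcs X -> e \in px_arcs I by rewrite inE => /andP[].
have usedA i : (v i, u i) \in px_arcs I by have := used i; rewrite inE => /andP[].
have resp i : {subset path_arcs (v i) (t i :: p i) <= residual_arcs X}.
  by case: (Hp i) => /mem_path_arcs.
have vtA i : (v i, t i) \in px_arcs I by apply/resA/(resp i)/mem_head.
have top i : exists x, 0 < d (v i, x) /\ px_pref I (v i) x (u i).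
  (* [x] is the best [t j] over all entries [j] of the agent [v i]. *)
  have [||x [/existsP[j /andP[/eqP vj /eqP tj]] xmax xbest]] :=
    @top_choice _ _ I (v i) (fun x => [exists j, (v j == v i) && (t j == x)]) (t i).
  - by move=> x /existsP[j /andP[/eqP<- /eqP<-]].
  - by apply/existsP; exists i; rewrite !eqxx.
  have xA : (v i, x) \in px_arcs I by rewrite -vj -tj.
  exists x; split.
    (* No entry gives up [(v i, x)]: it would move to an arc preferred to it, against the choice of
       [x]. *)
    have neg l : ((v l, u l) == (v i, x)) = false.
      apply/negP; rewrite xpair_eqE => /andP[/eqP vl /eqP ul].
      have [+ _] := Ht l; rewrite vl ul; apply/negP/xbest.
      by apply/existsP; exists l; rewrite vl !eqxx.
    rewrite /d (bigD1 j) //= neg subr0 ltr_wpDr //.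
      by apply: sumr_ge0 => l _; rewrite neg subr0.
    by rewrite ltr0n -has_count has_pred1 -vj -tj mem_head.
  have [<-|nt] := eqVneq (t i) x; first by case: (Ht i).
  apply: (px_pref_trans xA (vtA i) (usedA i)); last by case: (Ht i).
  by apply: xmax => //; apply/existsP; exists i; rewrite !eqxx.
exists d; split.
- move=> x; rewrite /d exchange_big [RHS]exchange_big /=.
  under eq_bigr do rewrite big_split sumrN -!natr_sum.
  under [RHS]eq_bigr do rewrite big_split sumrN -!natr_sum.
  rewrite !big_split !sumrN -!natr_sum /=.
  have outE : (\sum_(i < k) \sum_w ((v i, u i) == (x, w)) = \sum_(i < k) (v i == x))%N.
    apply: eq_bigr => i _; rewrite (bigD1 (u i)) //= big1 ?addn0 => [|w].
      by rewrite xpair_eqE eqxx andbT.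
    by rewrite xpair_eqE eq_sym => /negPf->; rewrite andbF.
  have inE : (\sum_(i < k) \sum_w ((v i, u i) == (w, x)) = \sum_(i < k) (u i == x))%N.
    apply: eq_bigr => i _; rewrite (bigD1 (v i)) //= big1 ?addn0 => [|w].
      by rewrite xpair_eqE eqxx.
    by rewrite xpair_eqE eq_sym => /negPf->.
  rewrite outE inE; apply/eqP; rewrite subr_eq addrAC eq_sym subr_eq -!natrD; apply/eqP.
  (* Path [i] ends at [u (ordS i)], so shifting the index matches its end with the head of the arc
     given up by the next entry. *)
  congr (_%:R); rewrite [(\sum_(i < k) (u i == x))%N](reindex_inj (@ordS_inj k)) -!big_split /=.
  apply: eq_bigr => i _; case: (Hp i) => _ _ lastp.
  by have := path_arcs_balance (v i) x (t i :: p i); rewrite /= lastp.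
- move=> e; apply: contraTT => eres; rewrite -leNgt; apply: sumr_le0 => i _.
  rewrite /c (count_memPn _) ?sub0r ?oppr_le0 //; apply: contra eres; exact: resp.
- move=> e; apply: contraTT => eused; rewrite -leNgt; apply: sumr_ge0 => i _.
  by case: eqP => [Ee|_]; [rewrite -Ee used in eused | rewrite subr0].
- move=> x w; have [/existsP[i /eqP[<- <-] _]|no] := boolP [exists i, (v i, u i) == (x, w)].
    exact: top.
  rewrite ltNge sumr_ge0 // => i _; rewrite negb_exists in no.
  by rewrite (negPf (forallP no i)) subr0.
- by have [x [dx _]] := top (Ordinal k_gt0); exists (v (Ordinal k_gt0), x); rewrite lt0r_neq0.
Qed.

(** * Coalitions from improving circulations *)

Lemma improving_coalition (R : realType) (V : finType) (I : px_instance R V)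
    (X : exchange I) (d : V * V -> R) :
  improving X d -> maximal_exchange X -> ~ coalition_free X.
Proof.
move=> dX acX cfX; have [cd d_gt0 d_lt0 dpref [e0 de0]] := dX.
pose S v := [exists t, 0 < d (v, t)].
have posS v t : 0 < d (v, t) -> S v by move=> dt; apply/existsP; exists t.
have negS v w : d (v, w) < 0 -> S v by case/dpref=> t [/posS].
have [T HT] : exists T : V -> V, forall v, S v ->
    0 < d (v, T v) /\ forall w, d (v, w) < 0 -> px_pref I v (T v) w.
  apply: (@fin_all_exists V (fun=> V)
    (fun v t => S v -> 0 < d (v, t) /\ forall w, d (v, w) < 0 -> px_pref I v t w)) => v.
  have [/existsP[t0 dt0]|] := boolP (S v); last by exists v.
  by have [t [dt tneg _]] := improving_top dX (lt0r_neq0 dt0); exists t.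
have [z0 Sz0] : exists v, S v.
  by case: e0 de0 => v w; case: ltgtP => // [/negS|/posS] Sv _; exists v.
have [u Hu] : exists u : V -> V, forall v, S v ->
    dipath_via (residual_arcs X) v (T v) (u v) /\ exists w, d (w, u v) < 0.
  apply: (@fin_all_exists V (fun=> V) (fun v u => S v ->
    dipath_via (residual_arcs X) v (T v) u /\ exists w, d (w, u) < 0)) => v.
  have [Sv|] := boolP (S v); last by exists v.
  have [u [Su vu [y Sy Eu]]] :=
    exit_dipath (f := T) acX (fun x Sx => d_gt0 _ (proj1 (HT x Sx))) Sv.
  exists u => _; split=> //; apply/existsP; apply: contraT.
  rewrite negb_exists => /forallP no.
  (* Being outside [S], [u] neither gains nor loses on its outgoing arcs; without a losing incoming
     arc, all incoming values would vanish, against the gain on [(y, u)]. *)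
  have out0 : \sum_w d (u, w) = 0.
    apply: big1 => w _; apply/eqP; case: ltgtP => // dw.
      by rewrite (negS _ _ dw) in Su.
    by rewrite (posS _ _ dw) in Su.
  have := cd u; rewrite out0 => /esym/eqP.
  rewrite psumr_eq0 => [/allP/(_ y)|w _]; last by rewrite leNgt.
  rewrite mem_index_enum => /(_ isT) /=.
  by rewrite gt_eqF // Eu; case: (HT y Sy).
have [J HJ] : exists J : V -> V, forall v, S v -> d (J v, u v) < 0.
  apply: (@fin_all_exists V (fun=> V) (fun v w => S v -> d (w, u v) < 0)) => v.
  have [Sv|] := boolP (S v); last by exists v.
  by have [_ [w]] := Hu v Sv; exists w.
have SJ v : S v -> S (J v) by move/HJ/negS.
have [y Sy [k k_gt0 Hk]] := periodic_point SJ Sz0.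
have Sit n : S (iter n J y) by elim: n => //= n; apply: SJ.
(* Entry [i] is the agent [iter i.+1 J y], which loses on the arc to the exit vertex of its
   predecessor [iter i J y]; its own path leads to its own exit vertex, hence the shift by one. *)
apply: (cfX k (fun i => iter i.+1 J y) (fun i => u (iter i J y)) k_gt0).
  by move=> i; apply/d_lt0/HJ; apply: Sit.
exists (fun i => T (iter i.+1 J y)) => i; split.
  by have [_] := HT _ (Sit i.+1); apply; apply: HJ; apply: Sit.
(* At the last index [ordS] wraps to 0, and the periodicity of [y] closes the coalition. *)
have -> : iter (ordS i) J y = iter i.+1 J y.
  rewrite /=; have := ltn_ord i; rewrite leq_eqVlt => /predU1P[Ei|lt_i].
    by rewrite -iterS Ei modnn Hk.
  by rewrite modn_small.
by case: (Hu _ (Sit i.+1)).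
Qed.

Theorem theorem2 (R : realType) (V : finType) (I : px_instance R V)
    (X : exchange I) :
  pareto_optimal X <->
  [/\ maximal_exchange X, trade_in_free X & coalition_free X].
Proof.
split=> [optX|[maxX _ cfX] Y /dominates_improving dX]; last first.
  exact: improving_coalition dX maxX cfX.
have cfX : coalition_free X.
  move=> k v u k_gt0 used [t Ht].
  have [d dX] := coalition_improving k_gt0 used Ht.
  exact: improving_not_pareto dX optX.
split=> //.
  by move=> C /dicycle_improving/improving_not_pareto.
move=> v u vu [t [tu vtu]].
by apply: (cfX 1%N (fun=> v) (fun=> u)) => //; exists (fun=> t).
Qed.
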